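(* There exists a Moufang loop $Q$ of order $2^{14}$ such that the inner mapping group $\mathrm{Inn}(Q)$ is abelian and $Q$ is nilpotent of nilpotency class exactly $3$.
   Context: A loop is a set $Q$ with a binary operation (written as juxtaposition) and a two-sided neutral element $1$ such that all left translations $L_x:Q\to Q$, $yL_x=xy$, and all right translations $R_x:Q\to Q$, $yR_x=yx$, are bijections. Mappings are written on the right of their arguments and composed from left to right. The inner mapping group $\mathrm{Inn}(Q)$ is the permutation group on $Q$ generated by all $T(x)=R_xL_x^{-1}$, $L(x,y)=L_xL_yL_{yx}^{-1}$ and $R(x,y)=R_xR_yR_{xy}^{-1}$ with $x,y\in Q$. The center is $Z(Q)=\{x\in Q : x\varphi=x \text{ for every } \varphi\in\mathrm{Inn}(Q)\}$. The iterated centra are $Z_0(Q)=1$, $Z_{i+1}(Q)/Z_i(Q)=Z(Q/Z_i(Q))$, and $Q$ is nilpotent of class $m$ if $m$ is the least integer with $Z_m(Q)=Q$. A loop is Moufang if it satisfies the identity $x(y(xz))=((xy)x)z$. *)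

(* Defs.v *)
From HB Require Import structures.
From mathcomp Require Import all_boot all_fingroup.

Set Implicit Arguments.
Unset Strict Implicit.
Unset Printing Implicit Defensive.

Import GroupScope.

HB.mixin Record isLoop Q := {
  lmul : Q -> Q -> Q;
  lone : Q;
  lmul1l : left_id lone lmul;
  lmul1r : right_id lone lmul;
  lmull_bij : forall x : Q, bijective (fun y : Q => lmul x y);
  lmulr_bij : forall x : Q, bijective (fun y : Q => lmul y x)
}.

#[short(type="loopType")]
HB.structure Definition Loop := {Q of isLoop Q}.

#[short(type="finLoopType")]
HB.structure Definition FinLoop := {Q of isLoop Q & Finite Q}.

Notation "x ** y" := (lmul x y) (at level 40, left associativity).
Notation "\e" := (@lone _) (at level 0).

Definition moufang (Q : loopType) : Prop :=
  forall x y z : Q, x ** (y ** (x ** z)) = ((x ** y) ** x) ** z.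

Definition lmul_closed (Q : loopType) (A : {pred Q}) : Prop :=
  {in A &, forall x y, x ** y \in A}.

(* In {perm Q}, the product s * t is "s, then t", so the products below read  *)
(* as for mappings written on the right of their arguments.                   *)
Section InnerMappings.

Variable Q : finLoopType.
Implicit Types x y z : Q.

Definition ltrans x : {perm Q} := perm (bij_inj (lmull_bij x)).
Definition rtrans x : {perm Q} := perm (bij_inj (lmulr_bij x)).

Lemma ltransE x y : ltrans x y = x ** y. Proof. by rewrite permE. Qed.
Lemma rtransE x y : rtrans x y = y ** x. Proof. by rewrite permE. Qed.

Definition innT x : {perm Q} := rtrans x * (ltrans x)^-1.
Definition innL x y : {perm Q} := ltrans x * ltrans y * (ltrans (y ** x))^-1.
Definition innR x y : {perm Q} := rtrans x * rtrans y * (rtrans (x ** y))^-1.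

Definition inner_gens : {set {perm Q}} :=
  [set innT x | x : Q]
    :|: [set innL x y | x : Q, y : Q] :|: [set innR x y | x : Q, y : Q].

Definition Inn : {group {perm Q}} := [group of <<inner_gens>>].

Definition loop_center : {set Q} := [set x | [forall f in Inn, f x == x]].

(* Division in Q: x \ y and y / x.                                            *)
Definition ldiv x y : Q := (ltrans x)^-1 y.
Definition rdiv y x : Q := (rtrans x)^-1 y.

(* Normal subloops: subloops stabilised by all inner mappings.                *)
Record normal_subloop := NormalSubloop {
  nsl_set :> {set Q};
  nsl1 : \e \in nsl_set;
  nslM : {in nsl_set &, forall x y, x ** y \in nsl_set};
  nsl_ldiv : {in nsl_set &, forall x y, ldiv x y \in nsl_set};
  nsl_rdiv : {in nsl_set &, forall x y, rdiv x y \in nsl_set};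
  nsl_inn : forall f, f \in Inn -> {in nsl_set, forall x, f x \in nsl_set}
}.

Lemma innT_in x : innT x \in Inn.
Proof. by apply: mem_gen; rewrite !inE imset_f. Qed.

Lemma innL_in x y : innL x y \in Inn.
Proof. by apply: mem_gen; rewrite !inE imset2_f ?orbT. Qed.

Lemma innR_in x y : innR x y \in Inn.
Proof. by apply: mem_gen; rewrite !inE imset2_f ?orbT. Qed.

Lemma innTE x z : x ** innT x z = z ** x.
Proof. by rewrite -[LHS]ltransE permM permKV rtransE. Qed.

Lemma innLE x y z : (y ** x) ** innL x y z = y ** (x ** z).
Proof. by rewrite -[LHS]ltransE permM permKV permM !ltransE. Qed.

Lemma innRE x y z : innR x y z ** (x ** y) = (z ** x) ** y.
Proof. by rewrite -[LHS]rtransE permM permKV permM !rtransE. Qed.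

Lemma inn_stab (A : {set Q}) :
    (forall x, {in A, forall z, innT x z \in A}) ->
    (forall x y, {in A, forall z, innL x y z \in A}) ->
    (forall x y, {in A, forall z, innR x y z \in A}) ->
  forall f, f \in Inn -> {in A, forall z, f z \in A}.
Proof.
move=> sT sL sR.
suff sI : Inn \subset 'N(A | 'P).
  move=> f /(subsetP sI) fN z zA.
  by rewrite -[f z]/('P%act z f) (astabs_act z fN).
rewrite gen_subG; apply/subsetP => f; rewrite !inE => /orP[/orP[] | ].
- by case/imsetP=> x _ ->; apply/subsetP=> z zA; rewrite inE; exact: sT.
- by case/imset2P=> x y _ _ ->; apply/subsetP=> z zA; rewrite inE; exact: sL.
- by case/imset2P=> x y _ _ ->; apply/subsetP=> z zA; rewrite inE; exact: sR.
Qed.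

Lemma perm_stab_inv (A : {set Q}) (f : {perm Q}) :
  {in A, forall z, f z \in A} -> {in A, forall z, f^-1 z \in A}.
Proof.
move=> fA z zA.
have /eqP eA : f @: A == A.
  rewrite eqEcard card_imset ?leqnn ?andbT; last exact: perm_inj.
  by apply/subsetP=> _ /imsetP[w wA ->]; exact: fA.
by move: zA; rewrite -{1}eA => /imsetP[w wA ->]; rewrite permK.
Qed.

Lemma lmul_closed_ldiv (A : {set Q}) :
  lmul_closed A -> {in A &, forall x y, ldiv x y \in A}.
Proof.
move=> cA x y xA yA; apply: perm_stab_inv yA => z zA.
by rewrite ltransE; exact: cA.
Qed.

Lemma lmul_closed_rdiv (A : {set Q}) :
  lmul_closed A -> {in A &, forall x y, rdiv x y \in A}.
Proof.
move=> cA x y xA yA; apply: perm_stab_inv xA => z zA.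
by rewrite rtransE; exact: cA.
Qed.

Definition mk_normal_subloop (A : {set Q}) (A1 : \e \in A) (AM : lmul_closed A)
    (AI : forall f, f \in Inn -> {in A, forall x, f x \in A}) :
  normal_subloop :=
  NormalSubloop A1 AM (lmul_closed_ldiv AM) (lmul_closed_rdiv AM) AI.

Lemma centerP z :
  reflect [/\ forall x, innT x z = z,
              forall x y, innL x y z = z & forall x y, innR x y z = z]
          (z \in loop_center).
Proof.
rewrite inE; apply: (iffP forall_inP) => [fix_z | [zT zL zR] f fI].
  split=> [x | x y | x y]; apply/eqP; apply: fix_z;
  [exact: innT_in | exact: innL_in | exact: innR_in].
rewrite -in_set1; apply: (inn_stab _ _ _ fI); last exact: set11.
- by move=> x w /set1P->; rewrite zT set11.
- by move=> x y w /set1P->; rewrite zL set11.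
- by move=> x y w /set1P->; rewrite zR set11.
Qed.

Lemma mulIgl x : injective (fun y => x ** y).
Proof. exact: bij_inj (lmull_bij x). Qed.
Lemma mulIgr x : injective (fun y => y ** x).
Proof. exact: bij_inj (lmulr_bij x). Qed.

Lemma centerE z :
  z \in loop_center <->
  [/\ forall x, z ** x = x ** z,
      forall x y, y ** (x ** z) = (y ** x) ** z
    & forall x y, (z ** x) ** y = z ** (x ** y)].
Proof.
split=> [/centerP[zT zL zR] | [zC zA1 zA2]].
  split=> [x | x y | x y]; first by rewrite -innTE zT.
    by rewrite -innLE zL.
  by rewrite -innRE zR.
apply/centerP; split=> [x | x y | x y].
- by apply: (@mulIgl x); rewrite innTE.
- by apply: (@mulIgl (y ** x)); rewrite innLE.
- by apply: (@mulIgr (x ** y)); rewrite innRE.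
Qed.

Lemma center1 : \e \in loop_center.
Proof. by apply/centerE; split=> *; rewrite ?lmul1r ?lmul1l. Qed.

Lemma centerM : lmul_closed loop_center.
Proof.
move=> z w /centerE[zC zA1 zA2] /centerE[wC wA1 wA2].
apply/centerE; split=> [x | x y | x y].
- by rewrite zA2 wC wA1 zC -wA1.
- by rewrite !wA1 zA1.
- by rewrite !(zA2, wA2).
Qed.

Lemma inn1 f : f \in Inn -> {in [set \e : Q], forall x, f x \in [set \e : Q]}.
Proof.
move=> fI _ /set1P->; rewrite inE.
by have := center1; rewrite inE => /forall_inP; apply.
Qed.

Lemma trivM : lmul_closed [set \e : Q].
Proof. by move=> _ _ /set1P-> /set1P->; rewrite lmul1r set11. Qed.

Definition trivial_nsl : normal_subloop :=
  mk_normal_subloop (set11 (\e : Q)) trivM inn1.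

End InnerMappings.

(* The quotient loop Q / N, whose elements are the cosets x N.                *)
Section Quotient.

Variables (Q : finLoopType) (N : normal_subloop Q).
Implicit Types x y z : Q.

Definition loop_coset x : {set Q} := [set x ** n | n in N].

Definition loop_cosets : {set {set Q}} := [set loop_coset x | x : Q].

Lemma mem_loop_cosets x : loop_coset x \in loop_cosets.
Proof. exact: imset_f. Qed.

Definition loop_quot : Type := {X | X \in loop_cosets}.
HB.instance Definition _ := Finite.on loop_quot.

Definition loop_pi x : loop_quot := Sub (loop_coset x) (mem_loop_cosets x).

Lemma loop_pi_surj (X : loop_quot) : exists x, loop_pi x == X.
Proof.
by case: X => X XP; have /imsetP[x _ eX] := XP; exists x; apply/eqP/val_inj.
Qed.

Definition loop_repr (X : loop_quot) : Q := xchoose (loop_pi_surj X).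

Lemma loop_reprK X : loop_pi (loop_repr X) = X.
Proof. exact/eqP/(xchooseP (loop_pi_surj X)). Qed.

(* (x N) (y N) := (x y) N, well defined by loop_piM below.                    *)
Definition loop_quot_mul (X Y : loop_quot) : loop_quot :=
  loop_pi (loop_repr X ** loop_repr Y).

Let cosetN x n m : n \in N -> m \in N -> (x ** n) ** m \in loop_coset x.
Proof.
move=> nN mN; have fI := groupVr (innL_in n x).
rewrite -[m](permKV (innL n x)) innLE imset_f //.
by apply: nslM => //; exact: nsl_inn.
Qed.

Lemma card_loop_coset x : #|loop_coset x| = #|N|.
Proof. by apply: card_imset; exact: mulIgl. Qed.

Lemma loop_coset_refl x : x \in loop_coset x.
Proof. by apply/imsetP; exists \e; rewrite ?lmul1r ?nsl1. Qed.

Lemma loop_pi_eq x y : reflect (loop_pi y = loop_pi x) (y \in loop_coset x).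
Proof.
apply: (iffP idP) => [yx | e]; last first.
  by have := congr1 val e => /= <-; exact: loop_coset_refl.
apply: val_inj => /=; apply/eqP; rewrite eqEcard !card_loop_coset leqnn andbT.
have /imsetP[n nN ->] := yx.
by apply/subsetP=> _ /imsetP[m mN ->]; exact: cosetN.
Qed.

Lemma loop_coset_mul x y u v :
  u \in loop_coset x -> v \in loop_coset y -> u ** v \in loop_coset (x ** y).
Proof.
case/imsetP=> n nN ->; case/imsetP=> m mN ->.
rewrite -innLE; set m' := innL _ _ m.
have m'N : m' \in N by apply: nsl_inn; rewrite ?innL_in.
rewrite -[n in x ** n](permKV (innT x)) innTE; set n' := _ n.
rewrite -(innRE x y n') -(innTE (x ** y) (innR _ _ _)).
apply: cosetN m'N; apply: nsl_inn; first exact: innT_in.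
apply: nsl_inn; first exact: innR_in.
by apply: nsl_inn nN; rewrite groupV innT_in.
Qed.

Lemma loop_piM x y : loop_pi (x ** y) = loop_quot_mul (loop_pi x) (loop_pi y).
Proof.
by apply/esym/loop_pi_eq/loop_coset_mul; apply/loop_pi_eq; exact: loop_reprK.
Qed.

Fact loop_quot_mul1l : left_id (loop_pi \e) loop_quot_mul.
Proof. by move=> X; rewrite -[X]loop_reprK -loop_piM lmul1l. Qed.

Fact loop_quot_mul1r : right_id (loop_pi \e) loop_quot_mul.
Proof. by move=> X; rewrite -[X]loop_reprK -loop_piM lmul1r. Qed.

Fact loop_quotl_bij X : bijective (fun Y => loop_quot_mul X Y).
Proof.
pose g (Y : loop_quot) := loop_pi (ldiv (loop_repr X) (loop_repr Y)).
have gK : cancel g (fun Y => loop_quot_mul X Y).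
  move=> Y; rewrite -{1}[X]loop_reprK -loop_piM -ltransE permKV.
  exact: loop_reprK.
exact: (bij_can_bij (injF_bij (can_inj gK)) gK).
Qed.

Fact loop_quotr_bij X : bijective (fun Y => loop_quot_mul Y X).
Proof.
pose g (Y : loop_quot) := loop_pi (rdiv (loop_repr Y) (loop_repr X)).
have gK : cancel g (fun Y => loop_quot_mul Y X).
  move=> Y; rewrite -{1}[X]loop_reprK -loop_piM -rtransE permKV.
  exact: loop_reprK.
exact: (bij_can_bij (injF_bij (can_inj gK)) gK).
Qed.

HB.instance Definition _ :=
  isLoop.Build loop_quot loop_quot_mul1l loop_quot_mul1r loop_quotl_bij
    loop_quotr_bij.

Lemma loop_pi_mul x y : loop_pi (x ** y) = loop_pi x ** loop_pi y.
Proof. exact: loop_piM. Qed.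

(* The full preimage in Q of the center of Q / N; it contains N, and its      *)
(* image in Q / N is that center.                                             *)
Definition center_preim_set : {set Q} :=
  loop_pi @^-1: loop_center loop_quot.

Let semi (f : {perm Q}) (g : {perm loop_quot}) :=
  forall z, loop_pi (f z) = g (loop_pi z).

Let semiM f1 f2 g1 g2 : semi f1 g1 -> semi f2 g2 -> semi (f1 * f2) (g1 * g2).
Proof. by move=> s1 s2 z; rewrite !permM s2 s1. Qed.

Let semiV f g : semi f g -> semi f^-1 g^-1.
Proof. by move=> s z; rewrite -{2}[z](permKV f) s permK. Qed.

Let semiL x : semi (ltrans x) (ltrans (loop_pi x)).
Proof. by move=> z; rewrite !ltransE loop_piM. Qed.

Let semiR x : semi (rtrans x) (rtrans (loop_pi x)).
Proof. by move=> z; rewrite !rtransE loop_piM. Qed.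

Lemma mem_center_preim x :
  (x \in center_preim_set) = (loop_pi x \in loop_center loop_quot).
Proof. by rewrite in_set. Qed.

Lemma center_preim1 : \e \in center_preim_set.
Proof. by rewrite inE; exact: center1. Qed.

Lemma center_preimM : lmul_closed center_preim_set.
Proof.
move=> x y; rewrite 3!mem_center_preim => xZ yZ; rewrite loop_piM.
exact: (centerM xZ yZ).
Qed.

Lemma center_preim_inn f :
  f \in Inn Q -> {in center_preim_set, forall x, f x \in center_preim_set}.
Proof.
have key f' g : g \in Inn loop_quot -> semi f' g ->
  {in center_preim_set, forall x, f' x \in center_preim_set}.
  move=> gI s x; rewrite in_set => xZ; rewrite in_set s.
  have := xZ; rewrite [in X in X -> _]inE => /forall_inP/(_ g gI)/eqP ->.
  exact: xZ.
apply: inn_stab => [x | x y | x y].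
- exact: key (innT_in (loop_pi x)) (semiM (semiR x) (semiV (semiL x))).
- apply: key (innL_in (loop_pi x) (loop_pi y)) _.
  apply: semiM; first exact: semiM (semiL x) (semiL y).
  by rewrite -[loop_pi y ** _]loop_piM; exact: semiV (semiL _).
- apply: key (innR_in (loop_pi x) (loop_pi y)) _.
  apply: semiM; first exact: semiM (semiR x) (semiR y).
  by rewrite -[loop_pi x ** _]loop_piM; exact: semiV (semiR _).
Qed.

Definition center_preim : normal_subloop Q :=
  mk_normal_subloop center_preim1 center_preimM center_preim_inn.

End Quotient.

(* Z_0(Q) = 1 and Z_(i+1)(Q) / Z_i(Q) = Z(Q / Z_i(Q)).                        *)
Fixpoint iter_center (Q : finLoopType) (i : nat) : normal_subloop Q :=
  if i is j.+1 then center_preim (iter_center Q j) else trivial_nsl Q.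

Definition has_nilpotency_class (Q : finLoopType) (m : nat) : Prop :=
  iter_center Q m = [set: Q] :> {set Q}
  /\ forall i, i < m -> iter_center Q i <> [set: Q] :> {set Q}.

(* Main.v *)
Require Import Defs.
From mathcomp Require Import all_boot all_fingroup.
From HB Require Import structures.
From mathcomp Require Import all_algebra ring.

Set Implicit Arguments.
Unset Strict Implicit.
Unset Printing Implicit Defensive.

(** Over a finite commutative ring R, put on R^3 x R^3 x R the product
      (a, b, c) (a', b', c')
        = (a + a', b + b' + h(a, a'), c + c' + a . (2 b' - h(a', a'))),
    where h(u, v)_i = u_j v_k for (i, j, k) cyclic is half of the cross product
    u x v = h(u, v) - h(v, u).  The first two coordinates form a group of class
    at most 2.  The last one is a central extension of this group by a map phi
    whose coboundary is the determinant: h(a, a') is minus the coboundary of b,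
    and h(a, a') + h(a', a) is minus the coboundary of a |-> h(a, a), so that
    a x a' = 2 h(a, a') - (h(a, a') + h(a', a)) is the coboundary of
    h(a, a) - 2 b, and phi is minus the cup product of a with that cochain.
    Hence the associator of x, y, z is det(a_x, a_y, a_z) ([detloop_assoc]).
    It is trilinear and alternating in the first coordinates, and this gives
    the Moufang identity ([detloop_moufang]).

    An iterated commutator [[x, y], z] equals -2 det(a_x, a_y, a_z).  If 2 <> 0
    in R it does not vanish identically, so the class is at least 3; the
    filtration by a = 0, then a = b = 0, shows that it is at most 3
    ([detloop_class3]).  Here T(y) and T(z) commute exactly when [[x, y], z] is
    symmetric in y and z for all x.  The determinant is antisymmetric, but
    twice the determinant is symmetric as soon as 4 = 0: all generators
    of the inner mapping group are shears, and the commutator of two shears is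
    a translation by 4 det ([shearC]).  The ring R = Z/4 has 4 = 0 <> 2, and
    the loop over it has 4^7 = 2^14 elements. *)

(** * Central elements modulo a normal subloop *)

Section IteratedCenters.

Variables (Q : finLoopType) (N : normal_subloop Q).
Implicit Types x y w n : Q.

Lemma loop_pi_mulN x n : n \in N -> loop_pi N (x ** n) = loop_pi N x.
Proof. by move=> nN; apply/loop_pi_eq; apply: imset_f. Qed.

(** The factor n is the commutator of x and y; it dies in the quotient by N,
    so this bounds the iterated centers from above. *)
Lemma commutator_center_preim x y n :
  x \in center_preim_set N -> x ** y = (y ** x) ** n -> n \in N.
Proof.
rewrite mem_center_preim => /centerE[xC _ _] e.
have /loop_pi_eq : loop_pi N (x ** y) = loop_pi N (y ** x).
  by rewrite !loop_pi_mul xC.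
by case/imsetP=> m mN; rewrite e => /mulIgl ->.
Qed.

(** The converse criterion: x is central modulo N when its commutators and its
    associators (in the two positions that define the center) lie in N. *)
Lemma mem_center_preimI x :
    (forall y, exists2 n, n \in N & x ** y = (y ** x) ** n) ->
    (forall y w, exists2 n, n \in N & w ** (y ** x) = ((w ** y) ** x) ** n) ->
    (forall y w, exists2 n, n \in N & (x ** y) ** w = (x ** (y ** w)) ** n) ->
  x \in center_preim_set N.
Proof.
move=> xC xA1 xA2; rewrite mem_center_preim; apply/centerE.
have piP X : exists y, X = loop_pi N y.
  by exists (loop_repr X); rewrite loop_reprK.
split=> [Y | Y W | Y W]; have [y ->] := piP Y.
- have [n nN e] := xC y.
  by rewrite -(loop_pi_mul N x) e -(loop_pi_mul N y) loop_pi_mulN.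
- have [w ->] := piP W; have [n nN e] := xA1 y w.
  rewrite -(loop_pi_mul N y) -(loop_pi_mul N w) e.
  by rewrite -(loop_pi_mul N w) -(loop_pi_mul N (w ** y)) loop_pi_mulN.
- have [w ->] := piP W; have [n nN e] := xA2 y w.
  rewrite -(loop_pi_mul N x) -(loop_pi_mul N (x ** y)) e.
  by rewrite -(loop_pi_mul N y) -(loop_pi_mul N x) loop_pi_mulN.
Qed.

End IteratedCenters.

Import GRing.Theory.

(** * The loop with associator the determinant *)

Section DetLoop.

Local Open Scope ring_scope.

Variable R : finComNzRingType.

Definition vec : Type := (R * R * R)%type.
HB.instance Definition _ := Finite.on vec.
HB.instance Definition _ := GRing.Zmodule.on vec.

Implicit Types (a b u v w : vec) (c : R).

Definition dot u v : R := u.1.1 * v.1.1 + u.1.2 * v.1.2 + u.2 * v.2.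

Definition halfcross u v : vec :=
  (u.1.2 * v.2, u.2 * v.1.1, u.1.1 * v.1.2).

Definition cross u v : vec := halfcross u v - halfcross v u.

Definition det u v w : R := dot u (cross v w).

Lemma vec0E : (0 : vec) = (0, 0, 0). Proof. by []. Qed.
Lemma vecDE u v : u + v = (u.1.1 + v.1.1, u.1.2 + v.1.2, u.2 + v.2).
Proof. by []. Qed.
Lemma vecNE u : - u = (- u.1.1, - u.1.2, - u.2).
Proof. by []. Qed.

Definition detloop : Type := (vec * vec * R)%type.
HB.instance Definition _ := Finite.on detloop.

Implicit Types x y z : detloop.

(** The value of phi on (u, _) and (v, b). *)
Definition twist u v b : R := 2%:R * dot u b - dot u (halfcross v v).

Definition detmul x y : detloop :=
  (x.1.1 + y.1.1, x.1.2 + y.1.2 + halfcross x.1.1 y.1.1,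
   x.2 + y.2 + twist x.1.1 y.1.1 y.1.2).

Definition detone : detloop := (0, 0, 0).


Ltac coords :=
  rewrite /det /cross /twist /dot /halfcross ?(vec0E, vecDE, vecNE) /=.

Fact detmul1l : left_id detone detmul.
Proof.
by case=> [[[[a1 a2] a3] [[b1 b2] b3]] c]; rewrite /detmul /=; coords;
  do ![congr (_, _)]; ring.
Qed.

Fact detmul1r : right_id detone detmul.
Proof.
by case=> [[[[a1 a2] a3] [[b1 b2] b3]] c]; rewrite /detmul /=; coords;
  do ![congr (_, _)]; ring.
Qed.

(** The coordinates a, b, c of the unknown factor can be cancelled one after
    the other: beyond an additive b, the second coordinate of the product
    depends on a only, and beyond an additive c the third on a and b only. *)
Fact detmull_bij x : bijective (fun y => detmul x y).
Proof.
apply: injF_bij => -[[a b] c] [[a' b'] c'] e.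
have /addrI /= ea := congr1 (fun z => z.1.1) e; rewrite -{}ea in e *.
have /addIr /addrI /= eb := congr1 (fun z => z.1.2) e; rewrite -{}eb in e *.
by have /addIr /addrI /= <- := congr1 snd e.
Qed.

Fact detmulr_bij x : bijective (fun y => detmul y x).
Proof.
apply: injF_bij => -[[a b] c] [[a' b'] c'] e.
have /addIr /= ea := congr1 (fun z => z.1.1) e; rewrite -{}ea in e *.
have /addIr /addIr /= eb := congr1 (fun z => z.1.2) e; rewrite -{}eb in e *.
by have /addIr /addIr /= <- := congr1 snd e.
Qed.

HB.instance Definition _ :=
  isLoop.Build detloop detmul1l detmul1r detmull_bij detmulr_bij.

(** The kernel of the central extension, where all associators lie. *)
Definition zc c : detloop := (0, 0, c).

Lemma mul_zc x c : x ** zc c = (x.1, x.2 + c).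
Proof.
move: x => [[[[a1 a2] a3] [[b1 b2] b3]] c'].
by rewrite /lmul /= /detmul /=; coords; do ![congr (_, _)]; ring.
Qed.

Lemma zc0 : zc 0 = \e. Proof. by []. Qed.

Lemma zcD x c d : x ** zc c ** zc d = x ** zc (c + d).
Proof. by rewrite !mul_zc /= addrA. Qed.

Lemma zcAC x y c : (x ** zc c) ** y = (x ** y) ** zc c.
Proof.
rewrite !mul_zc; move: x y => [u c1] [v c2].
by rewrite /lmul /= /detmul /=; congr (_, _); ring.
Qed.

Lemma zcA x y c : x ** (y ** zc c) = (x ** y) ** zc c.
Proof.
rewrite !mul_zc; move: x y => [u c1] [v c2].
by rewrite /lmul /= /detmul /=; congr (_, _); ring.
Qed.

(** The coboundary of phi is the determinant. *)
Lemma detloop_assoc x y z :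
  x ** (y ** z) = (x ** y) ** z ** zc (det x.1.1 y.1.1 z.1.1).
Proof.
rewrite mul_zc; move: x y z => [[a b] c] [[a' b'] c'] [[a'' b''] c''].
rewrite /lmul /= /detmul /=; congr (_, _, _); first by rewrite addrA.
  move: a a' a'' b b' b'' => [[? ?] ?] [[? ?] ?] [[? ?] ?] [[? ?] ?] [[? ?] ?].
  by move=> [[? ?] ?]; coords; do ![congr (_, _)]; ring.
move: a a' a'' b' b'' => [[? ?] ?] [[? ?] ?] [[? ?] ?] [[? ?] ?] [[? ?] ?].
by coords; ring.
Qed.

(** Two reassociations turn x (y (x z)) into ((x y) x) z; their associators
    det(x, y, x + z) and det(x + y, x, z) are opposite because the determinant
    alternates. *)
Lemma detloop_moufang : moufang detloop.
Proof.
move=> x y z; rewrite (detloop_assoc x y) (detloop_assoc (x ** y) x) zcD.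
suff -> : det (x ** y).1.1 x.1.1 z.1.1 + det x.1.1 y.1.1 (x ** z).1.1 = 0.
  by rewrite zc0 lmul1r.
rewrite /= /lmul /=.
move: x.1.1 y.1.1 z.1.1 => [[? ?] ?] [[? ?] ?] [[? ?] ?].
by coords; ring.
Qed.

Definition comm x y : detloop :=
  (0, cross x.1.1 y.1.1, twist x.1.1 y.1.1 y.1.2 - twist y.1.1 x.1.1 x.1.2).

Lemma detloop_comm x y : x ** y = (y ** x) ** comm x y.
Proof.
move: x y => [[a b] c] [[a' b'] c'].
rewrite /lmul /= /detmul /comm /=; congr (_, _, _).
- by rewrite addr0 addrC.
- move: a a' b b' => [[? ?] ?] [[? ?] ?] [[? ?] ?] [[? ?] ?].
  by coords; do ![congr (_, _)]; ring.
- move: a a' b b' => [[? ?] ?] [[? ?] ?] [[? ?] ?] [[? ?] ?].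
  by coords; ring.
Qed.

(** * Commuting inner mappings *)

(** The common shape of the generating inner mappings.  The function q is
    arbitrary because it has no influence on whether two shears commute: shears
    fix the coordinate on which q depends. *)
Definition shear u (q : vec -> R) x : detloop :=
  (x.1.1, x.1.2 + cross x.1.1 u, x.2 - 2%:R * dot u x.1.2 + q x.1.1).

Definition is_shear (f : {perm detloop}) := exists u q, f =1 shear u q.

Lemma innT_shear x : is_shear (innT x).
Proof.
exists x.1.1.
exists (fun a => twist a x.1.1 x.1.2 + dot x.1.1 (halfcross a a)) => z.
apply: (@mulIgl _ x); rewrite innTE.
move: x z => [[a b] c] [[a' b'] c'].
rewrite /lmul /= /detmul /shear /=; congr (_, _, _).
- exact: addrC.
- move: a a' b b' => [[? ?] ?] [[? ?] ?] [[? ?] ?] [[? ?] ?].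
  by coords; do ![congr (_, _)]; ring.
- move: a a' b b' => [[? ?] ?] [[? ?] ?] [[? ?] ?] [[? ?] ?].
  by coords; ring.
Qed.

Lemma shear0E q z : shear 0 q z = z ** zc (q z.1.1).
Proof.
rewrite mul_zc; move: z => [[[[? ?] ?] [[? ?] ?]] ?].
by rewrite /shear /=; coords; do ![congr (_, _)]; ring.
Qed.

Lemma innL_shear x y : is_shear (innL x y).
Proof.
exists 0; exists (fun a => det y.1.1 x.1.1 a) => z; rewrite shear0E.
by apply: (@mulIgl _ (y ** x)); rewrite innLE zcA detloop_assoc.
Qed.

Lemma innR_shear x y : is_shear (innR x y).
Proof.
exists 0; exists (fun a => - det a x.1.1 y.1.1) => z; rewrite shear0E.
apply: (@mulIgr _ (x ** y)); rewrite innRE zcAC detloop_assoc zcD subrr.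
by rewrite zc0 lmul1r.
Qed.

(** The two composites differ in the last coordinate by
    2 (u . (a x v)) - 2 (v . (a x u)) = 4 (u . (a x v)) up to sign. *)
Lemma shearC u q v r : 4%:R = 0 :> R ->
  forall x, shear u q (shear v r x) = shear v r (shear u q x).
Proof.
move=> R4 [[a b] c]; rewrite /shear /=; congr (_, _, _).
  by rewrite addrAC.
rewrite -[RHS]addr0 -(mul0r (det a u v)) -R4.
move: u v a b => [[? ?] ?] [[? ?] ?] [[? ?] ?] [[? ?] ?].
by coords; ring.
Qed.

Lemma detloop_Inn_abelian : 4%:R = 0 :> R -> abelian (Inn detloop).
Proof.
move=> R4; rewrite /Inn /= abelian_gen.
have shearI f : f \in inner_gens detloop -> is_shear f.
  rewrite !inE => /orP[/orP[] | ].
  - by case/imsetP=> x _ ->; exact: innT_shear.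
  - by case/imset2P=> x y _ _ ->; exact: innL_shear.
  - by case/imset2P=> x y _ _ ->; exact: innR_shear.
apply/centsP=> f /shearI[u [q fE]] g /shearI[v [r gE]].
by apply/permP=> x; rewrite !permM [LHS]gE [RHS]fE [f x]fE [g x]gE shearC.
Qed.

(** * The upper central series *)

(** The alternating determinant makes one position of x in the associator
    sufficient. *)
Lemma mem_iter_center i x :
    (forall y, comm x y \in iter_center detloop i) ->
    (forall v w, zc (det x.1.1 v w) \in iter_center detloop i) ->
  x \in iter_center detloop i.+1.
Proof.
move=> xC xA; apply: mem_center_preimI => [y | y w | y w].
- by exists (comm x y); rewrite -?detloop_comm.
- exists (zc (det w.1.1 y.1.1 x.1.1)); last exact: detloop_assoc.
  suff -> : det w.1.1 y.1.1 x.1.1 = det x.1.1 w.1.1 y.1.1 by [].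
  move: x.1.1 y.1.1 w.1.1 => [[? ?] ?] [[? ?] ?] [[? ?] ?].
  by coords; ring.
- exists (zc (det x.1.1 w.1.1 y.1.1)); first exact: xA.
  rewrite detloop_assoc zcD.
  suff -> : det x.1.1 y.1.1 w.1.1 + det x.1.1 w.1.1 y.1.1 = 0.
    by rewrite zc0 lmul1r.
  move: x.1.1 y.1.1 w.1.1 => [[? ?] ?] [[? ?] ?] [[? ?] ?].
  by coords; ring.
Qed.

Lemma comm_iter_center i x y :
  x \in iter_center detloop i.+1 -> comm x y \in iter_center detloop i.
Proof. by move=> /commutator_center_preim; apply; exact: detloop_comm. Qed.

Lemma comm0 x y : x.1.1 = 0 -> comm x y = zc (- (2%:R * dot y.1.1 x.1.2)).
Proof.
move: x y => [[a b] c] [[a' b'] c'] /= ->; rewrite /comm /zc /=.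
move: a' b b' => [[? ?] ?] [[? ?] ?] [[? ?] ?].
by coords; do ![congr (_, _)]; ring.
Qed.

Lemma det0v v w : det 0 v w = 0.
Proof. by rewrite /det /dot /= !mul0r !addr0. Qed.

Lemma zc_center c : zc c \in iter_center detloop 1.
Proof.
apply: mem_iter_center => [y | v w]; last by rewrite det0v nsl1.
suff -> : comm (zc c) y = \e by exact: nsl1.
by rewrite comm0 // /dot /= !mulr0 !addr0 mulr0 oppr0.
Qed.

Lemma mem_iter_center2 x : x.1.1 = 0 -> x \in iter_center detloop 2.
Proof.
move=> x0; apply: mem_iter_center => [y | v w]; last by rewrite x0 det0v nsl1.
by rewrite comm0 //; exact: zc_center.
Qed.

(** For the lower bound, take a basis e1, e2, e3 of the first coordinate: were
    the i-th center with i < 3 the whole loop, then it would contain the entry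
    of index i, counted from 0, of [[e1, e2], e3], [e1, e2], e1, whence
    [[e1, e2], e3] = 1 by descending to the trivial subloop; but its last coordinate is -2. *)
Lemma detloop_class3 : 2%:R != 0 :> R -> has_nilpotency_class detloop 3.
Proof.
move=> R2; split.
  apply/setP=> x; rewrite in_setT.
  by apply: mem_iter_center => *; exact: mem_iter_center2.
pose e1 : detloop := ((1, 0, 0), 0, 0).
pose e2 : detloop := ((0, 1, 0), 0, 0).
pose e3 : detloop := ((0, 0, 1), 0, 0).
pose g2 := comm (comm e1 e2) e3; pose g j := nth g2 [:: g2; comm e1 e2; e1] j.
have gZ i : (i < 3)%N -> g i \in iter_center detloop i -> g2 = \e.
  have base : g2 \in iter_center detloop 0 -> g2 = \e by move/set1P.
  case: i => [|[|[|//]]] _ //= gi; apply: base; rewrite /g2.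
    exact: comm_iter_center.
  by do 2![apply: comm_iter_center].
move=> i i3 iT; have := gZ i i3; rewrite iT in_setT => /(_ isT).
rewrite /g2 comm0 // => /(congr1 snd) /= /eqP.
rewrite oppr_eq0 => /eqP e; case/negP: R2; apply/eqP; rewrite -[RHS]e.
by rewrite /comm; coords; ring.
Qed.

Lemma card_detloop : #|{: detloop}| = (#|R| ^ 7)%N.
Proof. by rewrite !card_prod; ring. Qed.

End DetLoop.

Theorem mainTheorem3 :
  exists Q : finLoopType,
    [/\ #|Q| = (2 ^ 14)%N,
        moufang Q,
        abelian (Inn Q)
      & has_nilpotency_class Q 3].
Proof.
exists (detloop 'Z_4); split.
- by rewrite card_detloop card_ord (expnM 2 2 7).
- exact: detloop_moufang.
- by apply: detloop_Inn_abelian; apply/eqP.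
- by apply: detloop_class3.
Qed.
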